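(* There exists $k_0$ such that for every integer $k\ge k_0$ and every positive integer $n$, there is a set $S$ of vertices of the $n$-cube $Q_n$ with $|S|<2^{-k}\cdot 2^n$ such that $S$ intersects the vertex set of every subcube of $Q_n$ of dimension $d=2k+\lceil 3\log_2 k\rceil$.
   Context: $Q_n$ denotes the discrete $n$-cube with vertex set $\{0,1\}^n$. A subcube of dimension $d$ (a $d$-subcube) of $Q_n$ is a set of $2^d$ vertices obtained by fixing the values of some $n-d$ coordinates and letting the remaining $d$ coordinates vary freely over $\{0,1\}$. (If $d>n$ there are no such subcubes.) *)

(* Defs.v *)
From mathcomp Require Import all_boot all_order all_algebra.
From mathcomp Require Import reals exp.

Set Implicit Arguments.
Unset Strict Implicit.
Unset Printing Implicit Defensive.

Import Order.TTheory GRing.Theory Num.Theory.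

Local Open Scope ring_scope.

Definition cube (n : nat) : finType := {ffun 'I_n -> bool}.

Definition subcube (n : nat) (F : {set 'I_n}) (a : cube n) : {set cube n} :=
  [set x : cube n | [forall i, (i \notin F) ==> (x i == a i)]].

Definition is_subcube (n d : nat) (C : {set cube n}) : Prop :=
  exists (F : {set 'I_n}) (a : cube n), #|F| = d /\ C = subcube F a.

Definition log2 (R : realType) (x : R) : R := ln x / ln 2.

(* The ceiling is an int; it is nonnegative for k >= 1, so the absolute value
   is only a cast to nat. The value at k = 0 is meaningless (ln 0 = 0). *)
Definition subcube_dim (R : realType) (k : nat) : nat :=
  (2 * k + `|Num.ceil (3 * log2 (k%:R : R))|)%N.

Fact card_subcube (n : nat) (F : {set 'I_n}) (a : cube n) :
  #|subcube F a| = (2 ^ #|F|)%N.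
Proof.
pose D (i : 'I_n) : pred bool := if i \in F then predT else pred1 (a i).
have := @card_family _ (fun=> bool) D; rewrite foldrE big_image /=.
rewrite (bigID (mem F)) /= [X in (_ * X)%N]big1 ?muln1; last first.
  by move=> i /negPf iF; rewrite /D iF card1.
rewrite (eq_bigr (fun=> 2%N)) => [|i iF]; last first.
  by rewrite /D iF -card_bool; apply: eq_card.
rewrite prod_nat_const => <-; apply: eq_card => x; rewrite inE.
by apply: eq_forallb => i; rewrite -[RHS]/(D i (x i)) /D; case: (i \in F).
Qed.

(* Main.v *)
(* On level r >= k of the cube, label the coordinates by random vectors of
   F_2^(r-k) and put into S the r-sets whose labels do not span; a union bound
   over the nonzero functionals shows that some labelling makes this less than a
   2^-k fraction of the level. Suppose a d-subcube with free coordinates F and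
   set A of coordinates fixed to 1 misses S, and put s = floor(d/2) and
   r = |A| + s. By pigeonhole, 2^(s-k) functionals on F_2^(r-k) take the same
   values on the labels of A. Two of them agree on fewer than s labels of F,
   since otherwise their difference vanishes on an r-set of the subcube. The
   Plotkin bound then gives 2 * 2^(s-k) <= d + 2, which fails for
   d = 2k + ceil(3 log2 k) and k >= 9. *)
Require Import Defs.
From mathcomp Require Import all_boot all_order all_algebra.
From mathcomp Require Import reals exp.
From mathcomp Require Import zify.

Set Implicit Arguments.
Unset Strict Implicit.
Unset Printing Implicit Defensive.

Import Order.TTheory GRing.Theory Num.Theory.

Local Open Scope ring_scope.

(** * Pigeonhole and the Plotkin bound *)

Lemma pigeonhole_fiber (T U : finType) (f : T -> U) (B : {set U}) (q : nat) :
  (forall x, f x \in B) -> (0 < #|B|)%N -> (#|B| * q <= #|T|)%N ->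
  exists y, (q <= #|[set x | f x == y]|)%N.
Proof.
move=> fB B0 hq; apply/existsP; rewrite -[X in is_true X]negbK negb_exists.
apply/negP => /forallP small; move: hq; apply/negP; rewrite -ltnNge.
rewrite -[X in (X < _)%N]sum1_card (partition_big f (mem B)) => [|x _]; last exact: fB.
set F := (X in (X < _)%N); suff: (F + #|B| <= #|B| * q)%N by lia.
rewrite -sum_nat_const -sum1_card /F -big_split /=; apply: leq_sum => z _.
by have := small z; rewrite -ltnNge -sum1dep_card addn1.
Qed.

(* Plotkin bound: count the pairs of words agreeing at a coordinate; each
   coordinate contributes at least half of all ordered pairs. *)
Lemma plotkin (U I : finType) (c : U -> I -> bool) (X : {set U})
    (D : {set I}) (s : nat) :
  (s.*2 <= #|D|)%N ->
  {in X &, forall u v, u != v -> #|[set i in D | c u i == c v i]| < s}%N ->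
  (2 * #|X| <= #|D| + 2)%N.
Proof.
move=> hs agree_lt.
pose agree u v := (\sum_(i in D) (c u i == c v i))%N.
have agreeE u v : agree u v = #|[set i in D | c u i == c v i]|.
  by rewrite -sum1dep_card /agree big_mkcondr.
have upper : (\sum_(u in X) \sum_(v in X) agree u v <=
              #|X| * (#|D| + #|X|.-1 * s.-1))%N.
  rewrite -sum_nat_const; apply: leq_sum => u uX.
  rewrite (bigD1 u) //= leq_add //.
    by rewrite agreeE; apply/subset_leq_card/subsetP => i; rewrite inE => /andP[].
  rewrite (cardsD1 u X) uX /= -sum_nat_const.
  rewrite (eq_bigl (mem (X :\ u))) => [|v]; last by rewrite !inE andbC.
  apply: leq_sum => v; rewrite !inE => /andP[vu vX].
  by rewrite agreeE; have := agree_lt u v uX vX; rewrite eq_sym => /(_ vu); lia.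
have lower : (#|D| * (#|X| * #|X|) <=
              2 * \sum_(u in X) \sum_(v in X) agree u v)%N.
  under eq_bigr do rewrite exchange_big /=.
  rewrite exchange_big /= big_distrr /= -sum_nat_const.
  apply: leq_sum => i _.
  pose Y b := [set u in X | c u i == b].
  have sumY b : (\sum_(v in X) (b == c v i) = #|Y b|)%N.
    rewrite -sum1dep_card big_mkcondr /=; apply: eq_bigr => v _.
    by rewrite eq_sym; case: eqP.
  have cardX : #|X| = (#|Y true| + #|Y false|)%N.
    rewrite -!sumY -big_split /= -sum1_card; apply: eq_bigr => v _.
    by case: (c v i).
  under eq_bigr do rewrite sumY.
  have -> : (\sum_(u in X) #|Y (c u i)| =
             #|Y true| * #|Y true| + #|Y false| * #|Y false|)%N.
    have sqY b : (#|Y b| * #|Y b| = \sum_(v in X) (b == c v i) * #|Y b|)%N.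
      by rewrite -big_distrl sumY.
    rewrite !sqY -big_split /=; apply: eq_bigr => u _.
    by case: (c u i); rewrite !(mul1n, mul0n, addn0, add0n).
  rewrite cardX; have [+ _] := nat_AGM2 #|Y true| #|Y false|; rewrite -mulnn.
  by move: #|Y true| #|Y false| => a b; lia.
have [->|X0] := posnP #|X|; first by lia.
have := leq_trans lower (leq_mul (leqnn 2) upper).
(* For s > 0, cancelling |X| leaves |D||X| <= 2|D| + 2(|X|-1)(s-1), and 2(s-1) <= |D|-2 turns this
   into 2|X| <= |D| + 2. For s = 0 the predecessor truncates, but then no two words of X can be
   distinct. *)
have [s0|s0] := posnP s.
  rewrite s0 muln0 addn0 => h.
  have: (#|X| <= 1)%N; last by lia.
  apply/card_le1P => u uX v; rewrite inE.
  apply/idP/idP => [vX|/eqP->//].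
  apply/negPn/negP => vu; have := agree_lt v u vX uX vu; by rewrite s0.
case: s s0 hs {agree_lt upper} => // s _ hs /=.
case: #|X| X0 => // M _ /=; case: #|D| hs => [|d]; nia.
Qed.

(** * Random labellings by vectors over F_2 *)

Section RandomVectors.
Variables (n m : nat).
Local Notation vectors := {ffun 'I_n -> 'cV['F_2]_m}.
Implicit Types (u : 'rV['F_2]_m) (w : 'cV['F_2]_m).
Implicit Types (G : vectors) (R : {set 'I_n}).

Definition orthogonal u w := (u *m w) 0 0 == 0.

(* By duality, the vectors indexed by R span the whole space iff no nonzero
   functional vanishes on all of them. *)
Definition spans G R :=
  [forall u, (u != 0) ==> ~~ [forall i in R, orthogonal u (G i)]].

Lemma F2_eq0_inj (a b : 'F_2) : (a == 0) = (b == 0) -> a = b.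
Proof. by case: a b => [[|[|?]] ?] [[|[|?]] ?] //= _; apply/val_inj. Qed.

(** A scalar of F_2 is determined by whether it vanishes, so functionals with the same vanishing at
    [w] have equal values there. *)
Lemma orthogonalB u v w :
  orthogonal u w = orthogonal v w -> orthogonal (u - v) w.
Proof.
by move/F2_eq0_inj => e; rewrite /orthogonal mulmxBl mxE [X in _ + X]mxE e subrr.
Qed.

(** Translation by a basis vector on which [u] is nonzero exchanges the kernel of [u] with its
    complement. *)
Lemma card_orthogonal u :
  u != 0 -> (#|[pred w | orthogonal u w]| * 2)%N = #|{: 'cV['F_2]_m}|.
Proof.
case/rV0Pn => j uj.
pose t (w : 'cV['F_2]_m) := w + delta_mx j 0.
have tE w : orthogonal u (t w) = ~~ orthogonal u w.
  rewrite /orthogonal mulmxDr -colE mxE [X in _ + X]mxE.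
  by case: (u 0 j) uj => [[|[|?]] ?] //; case: (X in X + _) => [[|[|?]] ?].
have tI : injective t by apply: addIr.
rewrite -(cardC [pred w | orthogonal u w]) muln2 -addnn; congr addn.
rewrite -(card_image tI); apply: eq_card => w; rewrite !inE.
apply/imageP/idP => [[v]|].
  by rewrite !inE => ov ->; rewrite tE ov.
move=> ow; exists (w - delta_mx j 0); last by rewrite /t subrK.
by have := tE (w - delta_mx j 0); rewrite /t subrK inE => e; move: ow; rewrite e negbK.
Qed.

Lemma card_orthogonal_family u R : u != 0 ->
  (#|[set G : vectors | [forall i in R, orthogonal u (G i)]]| * 2 ^ #|R|)%N =
  #|{: vectors}|.
Proof.
move=> u0.
pose Q (i : 'I_n) : pred 'cV['F_2]_m :=
  if i \in R then [pred w | orthogonal u w] else predT.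
have -> : #|[set G : vectors | [forall i in R, orthogonal u (G i)]]| = #|family Q|.
  apply: eq_card => G; rewrite inE; apply: eq_forallb => i.
  by rewrite -[RHS]/(Q i (G i)) /Q; case: (i \in R).
rewrite card_family foldrE big_image /= card_ffun.
rewrite -[in RHS]prod_nat_const -prod_nat_const.
rewrite (big_mkcond (mem R)) -big_split /=.
apply: eq_bigr => i _; rewrite /Q; case: ifP => _; last by rewrite muln1.
exact: card_orthogonal.
Qed.

(** First-moment argument: a nonzero functional vanishes on all labels of a given r-set for a
    fraction 2^-r of the labellings, and there are 2^m - 1 such functionals. *)
Lemma few_nonspanning (r : nat) :
  exists G, (#|[set R : {set 'I_n} | (#|R| == r) && ~~ spans G R]| * 2 ^ r
             <= 'C(n, r) * (2 ^ m).-1)%N.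
Proof.
set b := ('C(n, r) * _)%N.
pose bad G := [set R : {set 'I_n} | (#|R| == r) && ~~ spans G R].
pose van u R := [set G : vectors | [forall i in R, orthogonal u (G i)]].
apply/existsP; rewrite -[X in is_true X]negbK negb_exists.
apply/negP => /forallP big_bad.
suff: (\sum_G #|bad G| * 2 ^ r <= \sum_(G : vectors) b)%N.
  apply/negP; rewrite -ltnNge.
  have G0 : (0 < #|{: vectors}|)%N by apply/card_gt0P; exists 0.
  set F := (X in (_ < X)%N); set N := (X in (X < _)%N).
  suff: (N + #|{: vectors}| <= F)%N by lia.
  rewrite -sum1_card /F /N -big_split /=; apply: leq_sum => G _.
  by have := big_bad G; rewrite -ltnNge addn1.
have badE G : (#|bad G| <= \sum_(R : {set 'I_n} | #|R| == r)
                 \sum_(u : 'rV['F_2]_m | u != 0%R) (G \in van u R))%N.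
  rewrite -sum1_card (eq_bigl (fun R : {set 'I_n} => (#|R| == r) && ~~ spans G R)).
    2: by move=> R; rewrite inE.
  rewrite big_mkcondr /=; apply: leq_sum => R _.
  rewrite negb_forall; case: existsP => // -[u]; rewrite negb_imply negbK => /andP[u0 hu].
  by rewrite (bigD1 u) //= inE hu.
rewrite -big_distrl /= sum_nat_const.
apply: leq_trans (_ : (\sum_(R : {set 'I_n} | #|R| == r)
   \sum_(u : 'rV['F_2]_m | u != 0%R) #|van u R|) * 2 ^ r <= _)%N.
  rewrite leq_mul2r; apply/orP; right.
  apply: (@leq_trans (\sum_(G : vectors) \sum_(R : {set 'I_n} | #|R| == r)
                        \sum_(u : 'rV['F_2]_m | u != 0%R) (G \in van u R))%N).
    by apply: leq_sum => G _; exact: badE.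
  rewrite exchange_big /=; apply: leq_sum => R _.
  rewrite exchange_big /=; apply: leq_sum => u _.
  by rewrite -sum1_card [leqRHS]big_mkcond; apply: leq_sum => G _; case: ifP.
rewrite big_distrl /=.
under eq_bigr => R /eqP hR.
  rewrite big_distrl /=.
  under eq_bigr => u u0 do rewrite -{1}hR card_orthogonal_family //.
  rewrite sum_nat_const; over.
rewrite sum_nat_const.
rewrite (eq_card (B := predC1 (0 : 'rV['F_2]_m))) // cardC1 card_mx card_Fp // mul1n.
have -> : #|[pred R : {set 'I_n} | #|R| == r]| = 'C(n, r).
  by rewrite -cardsE card_draws card_ord.
rewrite mulnA [leqRHS]mulnC leq_mul //.
Qed.

End RandomVectors.

(** * Construction of the hitting set, level by level *)

Lemma card_by_size (n : nat) (T : {set {set 'I_n}}) :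
  #|T| = (\sum_(r < n.+1) #|[set E in T | #|E| == r]|)%N.
Proof.
rewrite -[LHS]sum1_card (partition_big (fun E : {set 'I_n} => inord #|E| : 'I_n.+1) predT) //=.
apply: eq_bigr => r _; rewrite -sum1dep_card; apply: eq_bigl => E.
by rewrite -val_eqE /= inordK // ltnS -[leqRHS]card_ord max_card.
Qed.

Lemma exists_subset_card (I : finType) (E : {set I}) (s : nat) :
  (s <= #|E|)%N -> exists2 B : {set I}, B \subset E & #|B| = s.
Proof.
move=> sE; exists [set i in take s (enum E)].
  by apply/subsetP => i; rewrite inE => /mem_take; rewrite mem_enum.
have /card_uniqP : uniq (take s (enum E)) by rewrite take_uniq ?enum_uniq.
by rewrite size_takel -?cardE // => e; rewrite -[RHS]e; apply: eq_card => i; rewrite inE.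
Qed.

Lemma sparse_hitting_set (n k s d : nat) :
  (k <= s)%N -> (s.*2 <= d)%N -> (d + 2 < 2 * 2 ^ (s - k))%N ->
  exists S : {set cube n}, (#|S| * 2 ^ k < 2 ^ n)%N /\
    forall C : {set cube n}, is_subcube d C -> S :&: C != set0.
Proof.
move=> ks sd dlt.
(* Each level has its own labelling. For r < k the truncated dimension r - k is 0; [T] excludes
   these levels. *)
pose G r := sval (sigW (few_nonspanning n (r - k) r)).
have few r := svalP (sigW (few_nonspanning n (r - k) r)).
pose supp (x : cube n) := [set i | x i].
pose T := [set E : {set 'I_n} | (k <= #|E|)%N && ~~ spans (G #|E|) E].
exists [set x | supp x \in T]; split.
  have supp_inj : injective supp.
    by move=> x y /setP e; apply/ffunP => i; have := e i; rewrite !inE.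
  have leT : (#|[set x | supp x \in T]| <= #|T|)%N.
    rewrite -(card_imset _ supp_inj); apply/subset_leq_card/subsetP => E.
    by case/imsetP => x; rewrite inE => ? ->.
  apply: leq_ltn_trans (leq_mul leT (leqnn _)) _.
  have -> : (2 ^ n)%N = #|[set: {set 'I_n}]|.
    by rewrite -powersetT card_powerset cardsT card_ord.
  rewrite !card_by_size big_distrl /=.
  set N := (X in (X < _)%N); set M := (X in (_ < X)%N).
  suff: (N + \sum_(r < n.+1) 1 <= M)%N by rewrite sum1_card card_ord; lia.
  rewrite /N /M -big_split /=; apply: leq_sum => -[r rn] _ /=; rewrite addn1.
  have -> : #|[set E in [set: {set 'I_n}] | #|E| == r]| = 'C(n, r).
    rewrite -[n in RHS]card_ord -card_draws; apply: eq_card => E.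
    by rewrite !inE.
  have [rk|kr] := ltnP r k.
    rewrite (_ : [set E in T | #|E| == r] = set0) ?cards0 ?bin_gt0 //.
    by apply/setP => E; rewrite !inE; case: eqP => [->|]; rewrite ?andbF // leqNgt rk.
  have sub : (#|[set E in T | #|E| == r]| <=
              #|[set E : {set 'I_n} | (#|E| == r) && ~~ spans (G r) E]|)%N.
    apply/subset_leq_card/subsetP => E; rewrite !inE => /andP[+ /eqP Er].
    by rewrite Er eqxx => /andP[].
  apply: leq_ltn_trans (leq_mul sub (leqnn _)) _.
  have C0 : (0 < 'C(n, r))%N by rewrite bin_gt0.
  have E0 : (0 < 2 ^ (r - k))%N by rewrite expn_gt0.
  (* The factor 2^(r-k) completes 2^k to the 2^r of [few]; strictness comes from leaving out the
     zero functional. *)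
  rewrite -(ltn_pmul2r E0) -mulnA -expnD subnKC //.
  apply: leq_ltn_trans (few r) _.
  by rewrite ltn_pmul2l // prednK.
move=> C [F [a [cardF ->]]]; apply/negP => /eqP miss.
pose A := [set i in ~: F | a i].
pose r := (#|A| + s)%N.
pose c u i := orthogonal u (G r i).
have [u|||y] := @pigeonhole_fiber _ _ (fun u => [set i in A | c u i])
    (powerset A) (2 ^ (s - k)).
- by rewrite powersetE; apply/subsetP => i; rewrite inE => /andP[].
- by rewrite card_powerset expn_gt0.
(* Since k <= s, the 2^(r-k) functionals are 2^|A| * 2^(s-k), against 2^|A| patterns on [A]. *)
- by rewrite card_powerset card_mx card_Fp // mul1n -expnD /r addnBA.
set X := [set u | _] => ybig.
suff: (2 * #|X| <= #|F| + 2)%N by rewrite cardF; lia.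
apply: (@plotkin _ _ c X F s); first by rewrite cardF.
move=> u v; rewrite !inE => /eqP uy /eqP vy uv; rewrite ltnNge; apply/negP.
(* Exactly s agreements are kept, so that [A :|: B] lies on level r, where [G r] is the labelling in
   force; its indicator is a vertex of the subcube, and [u - v] vanishes on all its labels. *)
case/exists_subset_card => B /subsetP Bagree cardB.
have BF i : i \in B -> i \in F by move/Bagree; rewrite inE => /andP[].
have cardE : #|A :|: B| = r.
  rewrite cardsU cardB (_ : A :&: B = set0) ?cards0 ?subn0 //.
  apply/setP => i; rewrite !inE; apply/negP => /andP[/andP[iF _] /BF].
  by rewrite (negPf iF).
pose x : cube n := [ffun i => i \in A :|: B].
suff: x \in set0 by rewrite inE.
have suppx : supp x = A :|: B by apply/setP => i; rewrite !inE ffunE !inE.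
rewrite -miss inE [X in X && _]inE suppx inE cardE.
rewrite -andbA; apply/and3P; split; first by rewrite /r; lia.
  rewrite negb_forall; apply/existsP; exists (u - v).
  rewrite negb_imply negbK subr_eq0 uv; apply/forall_inP => i.
  rewrite in_setU => /orP[iA|/Bagree iB]; apply: orthogonalB.
    by have /setP/(_ i) := etrans uy (esym vy); rewrite inE [RHS]inE iA.
  by move: iB; rewrite inE => /andP[_ /eqP].
rewrite inE; apply/forallP => i; apply/implyP => iF.
by rewrite ffunE !inE iF /=; case: (boolP (i \in B)) => [/BF|]; rewrite ?(negPf iF) ?orbF.
Qed.

(** * Arithmetic of the dimension d *)

Lemma dim_lt_expn_half (k L : nat) : (9 <= k)%N -> (k ^ 3 <= 2 ^ L)%N ->
  (2 * k + L + 2 < 2 * 2 ^ L./2)%N.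
Proof.
move=> k9; set h := L./2 => kL.
have Lh : (L <= h.*2.+1)%N by rewrite /h; lia.
have {}kL : (k ^ 3 <= 2 ^ h.*2.+1)%N by apply: leq_trans kL _; rewrite leq_exp2l.
have h4 : (4 < h)%N.
  (* 512 < 729 = 9^3 <= k^3. *)
  have: (2 ^ 9 < 2 ^ h.*2.+1)%N.
    by apply: leq_trans kL; apply: leq_trans (_ : 9 ^ 3 <= _)%N; rewrite // leq_exp2r.
  by rewrite ltn_exp2l //; lia.
case: h Lh kL h4 => // h Lh kL h4.
have hlt : (h.+3 <= 2 ^ h)%N.
  elim: h h4 {Lh kL} => // h IH; rewrite ltnS leq_eqVlt => /orP[/eqP<-//|/IH].
  by rewrite expnS; lia.
(* Here [h] is already the predecessor of [L./2]. If 2^h <= k, then k^3 <= 8 * (2^h)^2 <= 8 * k^2,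
   which contradicts k >= 9. *)
suff: (k < 2 ^ h)%N by rewrite expnS; lia.
rewrite ltnNge; apply/negP => hk.
have : (2 ^ h.+1.*2.+1 = 8 * (2 ^ h * 2 ^ h))%N.
  by rewrite -expnD -[8%N]/(2 ^ 3)%N -expnD; congr expn; lia.
have : (k ^ 3 = k * (k * k))%N by rewrite !expnS expn0 muln1.
nia.
Qed.

Lemma subcube_dim_expn (R : realType) (k : nat) : (0 < k)%N ->
  exists2 L, subcube_dim R k = (2 * k + L)%N & (k ^ 3 <= 2 ^ L)%N.
Proof.
move=> k0; exists `|Num.ceil (3 * log2 (k%:R : R))|%N => //.
set L := `|_|%N.
have k0R : (0 : R) < k%:R by rewrite ltr0n.
have ln2 : (0 : R) < ln 2 by rewrite ln_gt0 // ltr1n.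
have le_L : 3 * log2 (k%:R : R) <= L%:R.
  apply: le_trans (ceil_ge _) _.
  (* An integer is at most its absolute value, so the sign of the ceiling does not matter. *)
  by rewrite -[L%:R]/(L%:Z%:~R) ler_int /L abszE ler_norm.
rewrite -(ler_nat R) !natrX -ler_ln ?posrE ?exprn_gt0 // !lnXn //.
rewrite -[leLHS]mulr_natl -[leRHS]mulr_natl.
by rewrite -ler_pdivrMr // -mulrA.
Qed.

Theorem proposition1p1 (R : realType) :
  exists k0 : nat, forall k n : nat, (k0 <= k)%N -> (0 < n)%N ->
    exists S : {set cube n},
      (#|S|%:R : R) < 2 ^- k * 2 ^+ n /\
      forall C : {set cube n}, is_subcube (subcube_dim R k) C -> S :&: C != set0.
Proof.
exists 9 => k n k9 _.
have [|L -> kL] := @subcube_dim_expn R k; first by apply: leq_trans k9.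
have Lbound := dim_lt_expn_half k9 kL.
(* With d = 2k + L, the choice s = k + [L./2] is floor(d/2), so that s - k = [L./2]. *)
have [|||S [Slt Shit]] := @sparse_hitting_set n k (k + L./2) (2 * k + L).
- exact: leq_addr.
- by lia.
- by rewrite addKn.
exists S; split => //.
by rewrite mulrC ltr_pdivlMr ?exprn_gt0 // -!natrX -natrM ltr_nat.
Qed.
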